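(* Let $B$ be a Banach space, $D\subset B$ a dense subspace which is itself a Banach space with $\|\cdot\|_D\ge\|\cdot\|_B$. Let $M$ be a convex and bounded subset of $B^*$, $\sup_{\mu\in M}\|\mu\|_{B^*}\le M_0$, closed in the norm topologies of both $B^*$ and $D^*$. Let $T>0$ and let $A[t,\eta]:D\to B$, $t\in[0,T]$, $\eta\in M$, be linear operators such that for every $\mu\in M$: (i) there is a constant $c_1>0$ (independent of $\mu$) with, for all $\{\xi_\cdot\},\{\eta_\cdot\}\in C_\mu([0,T],M(D^* ))$, $$\sup_{t\in[0,T]}\|A[t,\xi_t]-A[t,\eta_t]\|_{D\to B}\le c_1\sup_{t\in[0,T]}\|\xi_t-\eta_t\|_{D^*},\qquad \sup_{t\in[0,T]}\|A[t,\xi_t]\|_{D\to B}\le c_1;$$ (ii) for every $\{\xi_\cdot\}\in C_\mu([0,T],M(D^* ))$ the operator curve $A[t,\xi_t]:D\to B$ generates a strongly continuous backward propagator $U^{t,s}[\{\xi_\cdot\}]$, $0\le t\le s\le T$, of bounded linear operators in $B$ on the common invariant domain $D$, with $\|U^{t,s}[\{\xi_\cdot\}]\|_{D\to D}\le c_2$, $\|U^{t,s}[\{\xi_\cdot\}]\|_{B\to B}\le c_3$ for positive constants $c_2,c_3$ (independent of $\mu$ and the curve), and with dual propagators $\tilde U^{s,t}[\{\xi_\cdot\}]$ preserving $M$. Then the Cauchy problem $$\frac{d}{dt}(f,\mu_t)=(A[t,\mu_t]f,\mu_t)\quad (f\in D),\qquad \mu_s=\mu,$$ is well-posed: for any $\mu\in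 M$, $s\in[0,T]$, it has a unique solution $U^{t,s}(\mu)\in M$, $t\in[s,T]$, and the transformations $U^{t,s}$ of $M$ form a propagator depending Lipschitz continuously on time $t$ and on the initial data in the norm of $D^*$, i.e. with a constant $c(T)$ $$\|U^{t,s}(\mu)-U^{t,s}(\eta)\|_{D^*}\le c(T)\|\mu-\eta\|_{D^*},\qquad \mu,\eta\in M,\ 0\le s\le t\le T .$$
   Context: $C_\mu([0,T],M(D^* ))$ is the set of curves $[0,T]\to M$, continuous in the norm of $D^*$, with value $\mu$ at time $0$. $(f,\mu)$ is the duality pairing. A (forward) propagator in a set $S$ is a family of maps $U^{t,r}:S\to S$, $r\le t$, with $U^{t,t}=\mathrm{Id}$ and $U^{t,s}U^{s,r}=U^{t,r}$ for $r\le s\le t$; for a backward propagator the same holds with $t\le s\le r$. A backward propagator of bounded linear operators is strongly continuous if it is strongly continuous in $t$ and $r$. A family $L_t:D\to B$ of bounded linear operators generates a backward propagator $U^{t,r}$ on the invariant domain $D$ if for $f\in D$, $\frac{d}{ds}U^{t,s}f=U^{t,s}L_sf$ and $\frac{d}{ds}U^{s,r}f=-L_sU^{s,r}f$ for $t\le s\le r$ (derivatives in $B$, one-sided at end points). Generators are assumed to depend strongly continuously on $t$. The dual propagator is $\tilde U^{s,t}=(U^{t,s})^*:B^*\to B^*$. Solutions are curves in $M$ continuous in the norm of $D^*$. *)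

(* Defs.v *)
From HB Require Import structures.
From mathcomp Require Import all_boot all_order all_algebra.
From mathcomp Require Import all_classical all_reals all_analysis.

Set Implicit Arguments.
Unset Strict Implicit.
Unset Printing Implicit Defensive.

Import Order.TTheory GRing.Theory Num.Theory.
Import numFieldNormedType.Exports.

Local Open Scope classical_set_scope.
Local Open Scope ring_scope.

(* The normed space of bounded (i.e. continuous) linear operators V -> W, with
   the operator norm sup {|f x| : |x| <= 1}. *)

Section bounded_operator_predicate.
Context {R : realType} (V W : normedModType R).

Definition bounded_operator : {pred (V -> W)} :=
  [pred f : V -> W | `[< linear f /\ continuous f >]].

Lemma bounded_operator_submod_closed : submod_closed bounded_operator.
Proof.
split=> [|a f g].
  by apply/asboolP; split=> [k x y|x]; [rewrite /= scaler0 addr0|exact: cvg_cst].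
move=> /asboolP[lf cf] /asboolP[lg cg]; apply/asboolP; split=> [k x y|x].
  rewrite !fctE lf lg !scalerDr !scalerA (mulrC a k) -!addrA; congr (_ + _).
  by rewrite addrCA.
by apply: cvgD; [apply: cvgZl_tmp; exact: cf|exact: cg].
Qed.

HB.instance Definition _ :=
  GRing.isSubmodClosed.Build _ _ bounded_operator bounded_operator_submod_closed.

Record bop := Bop { bop_fun : V -> W ; _ : bop_fun \in bounded_operator }.

HB.instance Definition _ := [isSub for bop_fun].
HB.instance Definition _ := [Choice of bop by <:].
HB.instance Definition _ := [SubChoice_isSubLmodule of bop by <:].

End bounded_operator_predicate.

Arguments bounded_operator {R} V W.

Coercion bop_fun : bop >-> Funclass.

Section bounded_operator_norm.
Context {R : realType} {V W : normedModType R}.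
Implicit Types f g : bop V W.

Lemma bop_linear f : linear f.
Proof. by case: f => f /= /asboolP[]. Qed.

HB.instance Definition _ f :=
  GRing.isLinear.Build R V W *:%R (bop_fun f) (bop_linear f).

Lemma bop_continuous f : continuous f.
Proof. by case: f => f /= /asboolP[]. Qed.

Lemma bopP f g : (forall x, f x = g x) -> f = g.
Proof. by move=> fg; apply: val_inj; apply/funext. Qed.

Definition opnorm f : R := sup [set `|f x| | x in [set x : V | `|x| <= 1]].

Lemma opnorm_has_sup f : has_sup [set `|f x| | x in [set x : V | `|x| <= 1]].
Proof.
split; first by exists `|f 0|; exists 0 => //=; rewrite normr0.
have /linear_bounded_continuous/bounded_funP/(_ 1)[M fM] := @bop_continuous f.
by exists M => _ [x /= x1 <-]; exact: fM.
Qed.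

Lemma opnorm_ub f x : `|x| <= 1 -> `|f x| <= opnorm f.
Proof.
move=> x1; apply: ub_le_sup; first by case: (opnorm_has_sup f).
by exists x.
Qed.

Lemma opnorm_lub f k : (forall x, `|x| <= 1 -> `|f x| <= k) -> opnorm f <= k.
Proof.
move=> fk; apply: ge_sup; first by case: (opnorm_has_sup f).
by move=> _ [x /= x1 <-]; exact: fk.
Qed.

Lemma opnorm_ge0 f : 0 <= opnorm f.
Proof. by apply: le_trans (opnorm_ub f (x := 0) _) => //; rewrite normr0. Qed.

Lemma opnormP f x : `|f x| <= opnorm f * `|x|.
Proof.
have [->|x0] := eqVneq x 0; first by rewrite linear0 !normr0 mulr0.
have nx : 0 < `|x| by rewrite normr_gt0.
have := @opnorm_ub f (`|x|^-1 *: x); rewrite normrZ normfV normr_id mulVf ?gt_eqF//.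
rewrite linearZ/= normrZ normfV normr_id => /(_ (lexx _)).
by rewrite ler_pdivrMl// mulrC.
Qed.

Lemma opnormD f g : opnorm (f + g) <= opnorm f + opnorm g.
Proof.
apply: opnorm_lub => x x1; rewrite (le_trans (ler_normD _ _))//.
by rewrite lerD// opnorm_ub.
Qed.

Lemma opnormZ_le k f : opnorm (k *: f) <= `|k| * opnorm f.
Proof.
apply: opnorm_lub => x x1; rewrite [X in `|X|](_ : _ = k *: f x)// normrZ.
by rewrite ler_wpM2l// opnorm_ub.
Qed.

Lemma opnormZ k f : opnorm (k *: f) = `|k| * opnorm f.
Proof.
apply/eqP; rewrite eq_le opnormZ_le /=.
have [->|k0] := eqVneq k 0; first by rewrite normr0 mul0r opnorm_ge0.
rewrite -ler_pdivlMl ?normr_gt0// -normfV.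
by rewrite (le_trans _ (opnormZ_le _ _))// scalerA mulVf// scale1r.
Qed.

Lemma opnorm_eq0 f : opnorm f = 0 -> f = 0.
Proof.
move=> f0; apply: bopP => x; apply/eqP; rewrite -normr_le0.
by rewrite (le_trans (opnormP f x))// f0 mul0r.
Qed.

HB.instance Definition _ :=
  Lmodule_isNormed.Build R (bop V W) opnormD opnormZ opnorm_eq0.

End bounded_operator_norm.

Definition dual {R : realType} (V : normedModType R) : Type := bop V R^o.

HB.instance Definition _ (R : realType) (V : normedModType R) :=
  NormedModule.on (dual V).

Section adjoint.
Context {R : realType} {V W : normedModType R}.

Lemma adjoint_subproof (U : bop V W) (mu : dual W) :
  (mu \o U : V -> R^o) \in bounded_operator V R^o.
Proof.
apply/asboolP; split=> [k x y|x]; first by rewrite /= !bop_linear.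
by apply: continuous_comp; exact: bop_continuous.
Qed.

Definition adjoint (U : bop V W) (mu : dual W) : dual V :=
  Bop (adjoint_subproof U mu).

End adjoint.

Section evolution.
Context {R : realType}.
Implicit Types (T s t r : R).

(* Difference quotients along points of J only: this is the one-sided
   derivative at an end point of an interval J, the ordinary derivative in its
   interior, and no condition at all when J = {t}. *)
Definition derivative_within {V : normedModType R} (J : set R) (g : R -> V) t
    (l : V) : Prop :=
  (r - t)^-1 *: (g r - g t) @[r --> within J t^'] --> l.

Definition forward_propagator {X : Type} T (S : set X) (U : R -> R -> X -> X) :=
  [/\ forall t r, 0 <= r -> r <= t -> t <= T ->
        forall x, S x -> S (U t r x),
      forall t, 0 <= t -> t <= T -> forall x, S x -> U t t x = x
    & forall t s r, 0 <= r -> r <= s -> s <= t -> t <= T ->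
        forall x, S x -> U t s (U s r x) = U t r x].

Definition backward_propagator {X : Type} T (S : set X) (U : R -> R -> X -> X) :=
  [/\ forall t r, 0 <= t -> t <= r -> r <= T ->
        forall x, S x -> S (U t r x),
      forall t, 0 <= t -> t <= T -> forall x, S x -> U t t x = x
    & forall t s r, 0 <= t -> t <= s -> s <= r -> r <= T ->
        forall x, S x -> U t s (U s r x) = U t r x].

Definition strongly_continuous_backward {B : normedModType R} T
    (U : R -> R -> bop B B) :=
  forall f : B, {within [set p : R * R | 0 <= p.1 <= p.2 /\ p.2 <= T],
    continuous (fun p : R * R => U p.1 p.2 f)}.

(* The subspace D of B is given as a normed space with an embedding iota, and
   UD is the restriction of U to D. *)
Definition generates {D B : normedModType R} (iota : bop D B) T
    (L : R -> bop D B) (U : R -> R -> bop B B) (UD : R -> R -> bop D D) :=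
  [/\ backward_propagator T [set: B] (fun t r => U t r : B -> B),
      strongly_continuous_backward T U,
      forall f : D, {within `[0, T], continuous (fun t => L t f)},
      forall t r, 0 <= t -> t <= r -> r <= T ->
        forall f : D, iota (UD t r f) = U t r (iota f)
    & forall t s r, 0 <= t -> t <= s -> s <= r -> r <= T -> forall f : D,
        derivative_within `[t, r] (fun q => U t q (iota f)) s (U t s (L s f)) /\
        derivative_within `[t, r] (fun q => U q r (iota f)) s
          (- L s (UD s r f))].

(* C_mu([0,T], M(D^* )); elements of B^* are regarded as elements of D^* by
   restriction to D, that is, through the adjoint of iota. *)
Definition curves {D B : normedModType R} (iota : bop D B) T
    (M : set (dual B)) (mu : dual B) : set (R -> dual B) :=
  [set xi | [/\ xi 0 = mu, forall t, 0 <= t -> t <= T -> M (xi t)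
    & {within `[0, T], continuous (fun t => adjoint iota (xi t))}]].

Definition sup_norm {V : normedModType R} T (g : R -> V) : \bar R :=
  ereal_sup [set (`|g t|)%:E | t in `[0, T]].

Definition cauchy_solution {D B : normedModType R} (iota : bop D B) T
    (M : set (dual B)) (A : R -> dual B -> bop D B) s (mu : dual B)
    (m : R -> dual B) : Prop :=
  [/\ m s = mu, forall t, s <= t -> t <= T -> M (m t),
      {within `[s, T], continuous (fun t => adjoint iota (m t))}
    & forall (f : D) t, s <= t -> t <= T ->
        derivative_within `[s, T] (fun r => m r (iota f)) t
          (m t (A t (m t) f))].

End evolution.

(* Main.v *)
Require Import Defs.
From HB Require Import structures.
From mathcomp Require Import all_boot all_order all_algebra.
From mathcomp Require Import all_classical all_reals all_analysis.
From mathcomp Require Import ring lra.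

(* A curve [m] solves the Cauchy problem iff it is a fixed point of the map
   sending [xi] to the dual evolution of the starting point under the
   propagator generated by [A t (xi t)]. If [m] satisfies the linear equation
   with coefficients [L], and [V] is the propagator generated by [L'], then
   [m r (V r t f)] has derivative [m r ((L r - L' r) (V r t f))] in [r]; this
   gives uniqueness for the linear equation ([L = L']) and, through the mean
   value inequality, an estimate of the difference of two dual evolutions by the
   difference of the curves driving them. In a norm with exponential weight in
   time the map is a contraction in the norm of the dual of [D], so the Picard
   iterates converge to a solution, and the same estimate gives uniqueness and
   Lipschitz dependence on the initial data. *)

Set Implicit Arguments.
Unset Strict Implicit.
Unset Printing Implicit Defensive.

Import Order.TTheory GRing.Theory Num.Theory.
Import numFieldNormedType.Exports.

Local Open Scope classical_set_scope.
Local Open Scope ring_scope.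

(** * Derivatives within a set *)

(** Clearing the denominator makes the excluded point [r = t] harmless, so the punctured
    neighbourhood disappears. The estimates on derivatives below are done in this form. *)
Lemma derivative_withinP (R : realType) (V : normedModType R) (J : set R)
    (g : R -> V) (t : R) (l : V) :
  derivative_within J g t l <->
  forall e : R, 0 < e -> exists2 d : R, 0 < d &
    forall r, J r -> `|r - t| < d ->
      `|g r - g t - (r - t) *: l| <= e * `|r - t|.
Proof.
split=> [/cvgrPdist_le gl e e0|gl].
  have /nbhs_ballP[d /= d0 dg] := gl e e0.
  exists d => // r Jr rt; have [->|rnt] := eqVneq r t.
    by rewrite !subrr scale0r subr0 !normr0 mulr0.
  have := dg r; rewrite /ball/= distrC => /(_ rt rnt Jr).
  have rt0 : r - t != 0 by rewrite subr_eq0.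
  move=> H; rewrite -ler_pdivrMr ?normr_gt0// mulrC -normfV -normrZ.
  by rewrite scalerBr scalerA mulVf// scale1r distrC.
apply/cvgrPdist_le => e e0; have [d d0 dg] := gl e e0.
apply/nbhs_ballP; exists d => //= r; rewrite /ball/= distrC => rt rnt Jr.
have rt0 : r - t != 0 by rewrite subr_eq0.
have := dg r Jr rt; rewrite -ler_pdivrMr ?normr_gt0// mulrC -normfV -normrZ.
by rewrite scalerBr scalerA mulVf// scale1r distrC.
Qed.

Lemma derivative_within_subset (R : realType) (V : normedModType R)
    (J J' : set R) (g : R -> V) (t : R) (l : V) :
  J' `<=` J -> derivative_within J g t l -> derivative_within J' g t l.
Proof.
move=> JJ /derivative_withinP gl; apply/derivative_withinP => e /gl[d d0 dg].
by exists d => // r /JJ; exact: dg.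
Qed.

Lemma derivative_within_continuous (R : realType) (V : normedModType R)
    (J : set R) (g : R -> V) (t : R) (l : V) :
  derivative_within J g t l ->
  forall e : R, 0 < e -> exists2 d : R, 0 < d &
    forall r, J r -> `|r - t| < d -> `|g r - g t| <= e.
Proof.
move=> /derivative_withinP gl e e0; have [d d0 dg] := gl 1 ltr01.
have l1 : 0 < 1 + `|l| by rewrite ltr_pwDl.
exists (Num.min d (e / (1 + `|l|))) => [|r Jr].
  by rewrite lt_min d0 divr_gt0.
rewrite lt_min => /andP[/(dg r Jr) gr]; rewrite ltr_pdivlMr// => /ltW.
apply: le_trans; rewrite -[g r - g t](subrK ((r - t) *: l)).
rewrite (le_trans (ler_normD _ _))// mulrDr mulr1 normrZ lerD//.
by rewrite (le_trans gr)// mul1r.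
Qed.

Lemma derivative_within_is_derive (R : realType) (h : R -> R^o) (s t r l : R) :
  s < r < t -> derivative_within `[s, t] h r l -> is_derive r 1 h l.
Proof.
move=> /andP[sr rt] /derivative_withinP hl.
suff H : (k^-1 *: ((h \o shift r) (k *: (1 : R^o)) - h r)) @[k --> 0^'] --> (l : R^o).
  by apply: DeriveDef; [apply/cvg_ex; exists l|exact/cvg_lim].
apply/cvgrPdist_le => /= e e0; have [d d0 dh] := hl e e0.
have m0 : 0 < Num.min d (Num.min (r - s) (t - r)).
  by rewrite !lt_min d0 !subr_gt0 sr rt.
apply/nbhs_ballP; exists (Num.min d (Num.min (r - s) (t - r))); first exact: m0.
move=> k; rewrite /ball/= sub0r normrN !lt_min => /and3P[kd ks kt] k0.
have [ks' kt'] : - k < r - s /\ k < t - r.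
  by split; apply: le_lt_trans ks || apply: le_lt_trans kt;
    [rewrite -normrN|]; exact: ler_norm.
have := dh (k + r); rewrite addrK /= in_itv/=.
have -> : s <= k + r <= t by apply/andP; split; lra.
move=> /(_ isT kd); rewrite -ler_pdivrMr ?normr_gt0// mulrC -normfV -normrZ.
by rewrite scalerBr scalerA mulVf// scale1r distrC [k%:A]mulr1.
Qed.

(** [phi - k] has a nonnegative derivative inside the interval and is continuous up to its ends,
    hence is nondecreasing, for [k = h] and for [k = - h]. Asking for the bound on [dh] only at
    interior points matters later: time 0, where the coefficients cannot be compared, is avoided. *)
Lemma mean_value_bound (R : realType) (h dh phi dphi : R -> R^o)
    (s t : R) :
  s <= t ->
  (forall r, s <= r <= t -> derivative_within `[s, t] h r (dh r)) ->
  (forall r : R, is_derive r 1 phi (dphi r)) ->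
  (forall r, s < r < t -> `|dh r| <= dphi r) ->
  `|h t - h s| <= phi t - phi s.
Proof.
move=> st hdh phid bnd.
have key (k dk : R -> R^o) :
    (forall r, s <= r <= t -> derivative_within `[s, t] k r (dk r)) ->
    (forall r, s < r < t -> `|dk r| <= dphi r) ->
    k t - k s <= phi t - phi s.
  move=> kdk kb.
  have drv x : x \in `]s, t[ -> is_derive x 1 (phi - k) (dphi x - dk x).
    rewrite in_itv/= => xst; have /andP[/ltW sx /ltW xt] := xst.
    apply: is_deriveB; apply: derivative_within_is_derive xst _.
    by apply: kdk; rewrite sx.
  suff : phi s - k s <= phi t - k t by lra.
  apply: (@ger0_derive1_le_cc R (phi - k) s t) => //.
  - by move=> x /drv [].
  - move=> x xst; have := drv x xst => -[_]; rewrite derive1E => ->.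
    rewrite subr_ge0; move: xst; rewrite in_itv/= => /kb.
    exact: le_trans (ler_norm _).
  - apply/subspace_continuousP => x; rewrite /= in_itv/= => xst; apply: cvgB.
      apply: cvg_within_filter; apply: differentiable_continuous.
      by apply/derivable1_diffP; have [] := phid x.
    have /derivative_within_continuous kc := kdk x xst.
    apply/cvgrPdist_le => /= e /kc[d d0 dk'].
    apply/nbhs_ballP; exists d => //= y; rewrite /ball/= => xy yst.
    by rewrite distrC dk'// distrC.
  - by rewrite in_itv/= lexx st.
  - by rewrite in_itv/= lexx st.
rewrite ler_norml; apply/andP; split; last exact: key hdh bnd.
rewrite lerNl; suff : - h t - (- h s) <= phi t - phi s by lra.
apply: (key (fun r => - h r) (fun r => - dh r)) => [r /hdh|r]; last first.
  by rewrite normrN; exact: bnd.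
move=> /derivative_withinP hd; apply/derivative_withinP => e /hd[d d0 dg].
exists d => // q Jq qr; rewrite scalerN -!opprD normrN; exact: dg.
Qed.

(** * Bounded operators and functionals *)

Lemma bop_norm_le (R : realType) (V W : normedModType R) (g : bop V W) (k : R) :
  0 <= k -> (forall x, `|g x| <= k * `|x|) -> `|g| <= k.
Proof.
move=> k0 gk; apply: opnorm_lub => x x1.
by rewrite (le_trans (gk x))// ler_piMr.
Qed.

Lemma bounded_linear_bop (R : realType) (V W : normedModType R) (l : V -> W)
    (k : R) :
  linear l -> (forall x, `|l x| <= k * `|x|) -> l \in bounded_operator V W.
Proof.
move=> ll lk; apply/asboolP; split=> // x.
have lB y z : l (y - z) = l y - l z.
  by rewrite addrC -scaleN1r ll scaleN1r addrC.
have k1 : 0 < `|k| + 1 by rewrite ltr_wpDl.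
apply/cvgrPdist_le => /= e e0; apply/nbhs_ballP; exists (e / (`|k| + 1)) => /=.
  by rewrite divr_gt0.
move=> y; rewrite -ball_normE/= ltr_pdivlMr// => xy.
rewrite -lB (le_trans (lk _))// (le_trans _ (ltW xy))// mulrC.
by rewrite ler_wpM2l// (le_trans (ler_norm k))// lerDl.
Qed.

Lemma bopB (R : realType) (V W : normedModType R) (f : bop V W) (x y : V) :
  f (x - y) = f x - f y.
Proof. exact: linearB. Qed.

Lemma bopZ (R : realType) (V W : normedModType R) (f : bop V W) (k : R) (x : V) :
  f (k *: x) = k *: f x.
Proof. exact: linearZ. Qed.

Lemma bop_subE (R : realType) (V W : normedModType R) (f g : bop V W) (x : V) :
  (f - g) x = f x - g x.
Proof. by []. Qed.

(** Completeness of [W] gives a pointwise limit. The rate [e] is uniform on the unit ball and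
    survives the limit, which yields boundedness of the limit and convergence in operator norm at
    once. *)
Lemma bop_complete (R : realType) (V : normedModType R)
    (W : completeNormedModType R) (u : nat -> bop V W) (e : nat -> R) :
  (forall n m, (n <= m)%N -> `|u m - u n| <= e n) -> e @ \oo --> (0 : R) ->
  exists l : bop V W, forall n, `|l - u n| <= e n.
Proof.
move=> ue e0.
have uxe x n m : (n <= m)%N -> `|u m x - u n x| <= e n * `|x|.
  move=> nm; rewrite [X in `|X|](_ : _ = (u m - u n) x)//.
  by rewrite (le_trans (opnormP _ _))// ler_wpM2r// ue.
have cu x : cvg (u n x @[n --> \oo]).
  apply/cauchy_cvgP/cauchy_exP => d d0.
  have ex0 : e n * `|x| @[n --> \oo] --> (0 : R).
    by rewrite -(mul0r `|x|); apply: cvgM => //; exact: cvg_cst.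
  have /cvgr0Pnorm_lt/(_ d d0)[N _ HN] := ex0.
  exists (u N x); exists N => // m /= Nm.
  rewrite -ball_normE/= distrC (le_lt_trans (uxe _ _ _ Nm))//.
  by rewrite (le_lt_trans (ler_norm _))// HN/=.
pose l x := lim (u n x @[n --> \oo]).
have ll : linear l.
  move=> k x y; apply: cvg_lim => //.
  under eq_cvg do rewrite bop_linear.
  by apply: cvgD; [apply: cvgZl_tmp; exact: cu|exact: cu].
have lu n x : `|l x - u n x| <= e n * `|x|.
  apply/ler_addgt0Pr => d d0.
  have /cvgrPdist_le/(_ d d0)[N _ HN] := cu x.
  have := HN (maxn n N) (leq_maxr _ _); have := uxe x _ _ (leq_maxl n N).
  set w := u (maxn n N) x => wn wl.
  by rewrite -(subrK w (l x)) -addrA [leRHS]addrC (le_trans (ler_normD _ _))// lerD.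
have lb : l \in bounded_operator V W.
  apply: (@bounded_linear_bop _ _ _ _ (e 0%N + `|u 0%N|)) => // x.
  rewrite -(subrK (u 0%N x) (l x)) (le_trans (ler_normD _ _))// mulrDl lerD//.
  exact: opnormP.
exists (Bop lb) => n; apply: bop_norm_le => [|x]; last exact: lu.
by apply: le_trans (ue n n (leqnn n)).
Qed.

Lemma adjointB (R : realType) (V W : normedModType R) (U : bop V W)
    (x y : dual W) :
  adjoint U (x - y) = adjoint U x - adjoint U y.
Proof. exact: bopP. Qed.

Lemma dense_range_approx (R : realType) (V W : normedModType R) (U : bop V W)
    (b : W) (e : R) :
  dense (range U) -> 0 < e -> exists a, `|b - U a| < e.
Proof.
move=> dU e0; have [||y [by_ [a _ Uay]]] := dU (ball b e).
- by exists b; exact: ballxx.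
- exact: ball_open.
by exists a; rewrite Uay; rewrite -ball_normE in by_.
Qed.

(** A bounded functional is determined by its values on a dense range. Equality in the dual of [B]
    can therefore be tested in the norm of the dual of [D]. *)
Lemma adjoint_inj (R : realType) (V W : normedModType R) (U : bop V W) :
  dense (range U) -> injective (adjoint U).
Proof.
move=> dU x y xy; apply: bopP => b; apply/eqP; rewrite -subr_eq0 -normr_le0.
apply/ler_addgt0Pr => e e0; rewrite add0r.
have k1 : 0 < `|x - y| + 1 by rewrite ltr_wpDl.
have [a] := dense_range_approx b dU (divr_gt0 e0 k1).
rewrite ltr_pdivlMr// => /ltW; apply: le_trans.
have -> : x b - y b = (x - y) (b - U a).
  have -> : (x - y) (b - U a) =
      x b - y b - (adjoint U x a - adjoint U y a) by rewrite bopB.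
  by rewrite xy subrr subr0.
by rewrite (le_trans (opnormP _ _))// mulrC ler_wpM2l// lerDl.
Qed.

(** Three-epsilon argument: the uniform bound [K] transports continuity from the dense range to
    every [b]. *)
Lemma weak_continuity_dense (R : realType) (V W : normedModType R)
    (U : bop V W) (J : set R) (m : R -> dual W) (K r : R) :
  dense (range U) -> J r -> (forall q, J q -> `|m q| <= K) ->
  (forall f (e : R), 0 < e -> exists2 d : R, 0 < d &
     forall q, J q -> `|q - r| < d -> `|m q (U f) - m r (U f)| <= e) ->
  forall b (e : R), 0 < e -> exists2 d : R, 0 < d &
     forall q, J q -> `|q - r| < d -> `|m q b - m r b| <= e.
Proof.
move=> dU Jr mK mU b e e0.
have K0 : 0 <= K by apply: le_trans (mK _ Jr).
(* Each of the three terms gets [e / 3]; [K + 1] instead of [K] keeps the divisor positive when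
   [K = 0]. *)
have k1 : 0 < 3 * (K + 1) by rewrite mulr_gt0// ltr_wpDl.
have [a] := dense_range_approx b dU (divr_gt0 e0 k1).
rewrite ltr_pdivlMr// => /ltW ab.
have e3 : 0 < e / 3 by rewrite divr_gt0.
have [d d0 dm] := mU a _ e3; exists d => // q Jq qr.
have est p : J p -> `|m p (b - U a)| <= e / 3.
  move=> Jp; rewrite (le_trans (opnormP _ _))//.
  rewrite ler_pdivlMr// (le_trans _ ab)// -mulrA mulrCA ler_wpM2l//.
  by rewrite mulrC ler_wpM2l// (le_trans (mK _ Jp))// lerDl.
have -> : m q b - m r b =
    m q (b - U a) + (m q (U a) - m r (U a)) - m r (b - U a).
  by rewrite !bopB; ring.
have := est _ Jq; have := est _ Jr; have := dm _ Jq qr.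
set x := m q (b - _); set y := _ - _ (U a); set z := m r (b - _) => hy hz hx.
rewrite (le_trans (ler_normB _ _))// (le_trans (lerD (ler_normD _ _) (lexx _)))//.
lra.
Qed.

(** * Linear evolution equations in the dual *)

(** A product rule in which [m] is differentiable only when tested on [D], while [g] is
    differentiable in the norm of [B]. The derivative [dg] need not lie in [D], so
    [m q dg --> m r dg] comes from boundedness and density. *)
Lemma pairing_derivative (R : realType) (D B : normedModType R)
    (iota : bop D B) (J : set R) (m : R -> dual B) (dm : D -> R^o) (K r : R)
    (g : R -> B) (a : D) (dg : B) :
  dense (range iota) -> J r -> (forall q, J q -> `|m q| <= K) ->
  (forall f, derivative_within J (fun q => m q (iota f)) r (dm f)) ->
  g r = iota a -> derivative_within J g r dg ->
  derivative_within J (fun q => m q (g q)) r (dm a + m r dg).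
Proof.
move=> diota Jr mK mdm gra /derivative_withinP gdg.
apply/derivative_withinP => e e0.
have K1 : 0 < 3 * (K + 1) by rewrite mulr_gt0// ltr_wpDl// (le_trans _ (mK _ Jr)).
have e3 : 0 < e / 3 by rewrite divr_gt0.
have [d1 d10 gd] := gdg _ (divr_gt0 e0 K1).
have mc f := derivative_within_continuous (mdm f).
have [d2 d20 md] := weak_continuity_dense diota Jr mK mc dg e3.
have /derivative_withinP/(_ _ e3)[d3 d30 ad] := mdm a.
exists (Num.min d1 (Num.min d2 d3)); first by rewrite !lt_min d10 d20.
move=> q Jq; rewrite !lt_min => /and3P[q1 q2 q3].
(* The remainder splits into the error of [g], the weak continuity of [m] at [dg], and the error of
   [m] at the fixed vector [a]. *)
have -> : m q (g q) - m r (g r) - (q - r) *: (dm a + m r dg) =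
    m q (g q - g r - (q - r) *: dg) + (q - r) * (m q dg - m r dg) +
    (m q (iota a) - m r (iota a) - (q - r) *: dm a).
  have scE (k x : R) : k *: (x : R^o) = k * x by [].
  by rewrite !bopB bopZ gra !scE; ring.
have h1 : `|m q (g q - g r - (q - r) *: dg)| <= e / 3 * `|q - r|.
  rewrite (le_trans (opnormP _ _))//.
  rewrite (le_trans (ler_wpM2l (opnorm_ge0 _) (gd q Jq q1)))//.
  rewrite mulrA ler_wpM2r// mulrCA ler_pM2l// ler_pdivrMr//.
  by rewrite mulrA mulVf// mul1r (le_trans (mK _ Jq))// lerDl.
have h2 : `|(q - r) * (m q dg - m r dg)| <= e / 3 * `|q - r|.
  by rewrite normrM mulrC ler_wpM2r// md.
have h3 := ad q Jq q3.
rewrite (le_trans (ler_normD _ _))// (le_trans (lerD (ler_normD _ _) (lexx _)))//.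
apply: le_trans (lerD (lerD h1 h2) h3) _.
by rewrite -!mulrDl ler_wpM2r//; lra.
Qed.

(** Here [L] is prescribed, so the equation is linear; the nonlinear one is the case
    [L r = A r (m r)]. *)
Definition weak_solution (R : realType) (D B : normedModType R)
    (iota : bop D B) (s T : R) (L : R -> bop D B) (m : R -> dual B) :=
  forall f r, s <= r <= T ->
    derivative_within `[s, T] (fun q => m q (iota f)) r (m r (L r f)).

(** The two terms compared are the end values of [q |-> m q (V q t (iota f))], because [V t t] is
    the identity. The majorant [phi] stays abstract: it is taken exponential in one use and zero in
    another. *)
Lemma weak_solution_compare (R : realType) (D B : normedModType R)
    (iota : bop D B) (s t T K : R) (L L' : R -> bop D B) (m : R -> dual B)
    (V : R -> R -> bop B B) (VD : R -> R -> bop D D) (phi dphi : R -> R^o)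
    (f : D) :
  dense (range iota) -> 0 <= s -> s <= t -> t <= T ->
  (forall q, s <= q <= T -> `|m q| <= K) ->
  weak_solution iota s T L m -> generates iota T L' V VD ->
  (forall r : R, is_derive r 1 phi (dphi r)) ->
  (forall r, s < r < t -> `|m r ((L r - L' r) (VD r t f))| <= dphi r) ->
  `|m t (iota f) - m s (V s t (iota f))| <= phi t - phi s.
Proof.
move=> diota s0 st tT mK msol [[_ Vid _] _ _ VDV dV] phid bnd.
have t0 : 0 <= t by apply: le_trans st.
have := @mean_value_bound R (fun q => m q (V q t (iota f)))
  (fun r => m r (L r (VD r t f)) + m r (- L' r (VD r t f))) phi dphi s t st.
rewrite /= Vid//; apply=> // [r rst|r rst]; last first.
  have -> : m r (L r (VD r t f)) + m r (- L' r (VD r t f)) =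
            m r ((L r - L' r) (VD r t f)) by rewrite bop_subE linearD.
  exact: bnd.
have /andP[sr rt] := rst.
apply: (@pairing_derivative _ _ _ iota _ m (fun g => m r (L r g)) K) => //.
- by move=> q /=; rewrite in_itv/= => /andP[sq qt]; apply: mK; rewrite sq (le_trans qt).
- move=> g; apply: (@derivative_within_subset _ _ `[s, T]).
    by move=> q /=; rewrite !in_itv/= => /andP[-> qt]; exact: le_trans tT.
  by apply: msol; rewrite sr (le_trans rt).
- by rewrite VDV// (le_trans s0).
- by have [] := dV s r t s0 sr rt tT f.
Qed.

(** * Frozen time, geometric convergence and regularity of weak solutions *)

Lemma lipschitz_within_continuous (R : realType) (V : normedModType R)
    (J : set R) (g : R -> V) (k : R) :
  (forall x y, J x -> J y -> `|g x - g y| <= k * `|x - y|) ->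
  {within J, continuous g}.
Proof.
move=> gk; apply/subspace_continuousP => x Jx.
have k1 : 0 < `|k| + 1 by rewrite ltr_wpDl.
apply/cvgrPdist_le => /= e e0; apply/nbhs_ballP.
exists (e / (`|k| + 1)) => /=; first by rewrite divr_gt0.
move=> y; rewrite -ball_normE/= ltr_pdivlMr// => /ltW xy Jy.
rewrite (le_trans (gk _ _ Jx Jy))// (le_trans _ xy)// mulrC ler_wpM2l//.
by rewrite (le_trans (ler_norm k))// lerDl.
Qed.

Lemma clamp_dist (R : realType) (s x y : R) :
  `|Num.max s x - Num.max s y| <= `|x - y|.
Proof.
rewrite /Num.max; case: ltP => sx; case: ltP => sy; rewrite ?subrr ?normr0//.
- by rewrite !ger0_norm; lra.
- by rewrite !ler0_norm; lra.
Qed.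

Lemma clamp_itv (R : realType) (s T x : R) :
  s <= T -> 0 <= x <= T -> s <= Num.max s x <= T.
Proof. by move=> sT /andP[_ xT]; rewrite le_max lexx ge_max sT. Qed.

(** Freezing a curve at its value at time [s] before [s] extends it from [[s, T]] to [[0, T]], the
    interval on which the assumptions on [A] take their curves. *)
Lemma within_continuous_clamp (R : realType) (V : normedModType R) (s T : R)
    (g : R -> V) :
  0 <= s -> s <= T -> {within `[s, T], continuous g} ->
  {within `[0, T], continuous (fun t => g (Num.max s t))}.
Proof.
move=> s0 sT /subspace_continuousP gc; apply/subspace_continuousP => x.
rewrite /= in_itv/= => /andP[x0 xT].
have st y : 0 <= y <= T -> `[s, T]%classic (Num.max s y).
  by move=> /andP[_ yT]; rewrite /= in_itv/= le_max lexx ge_max sT.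
have := gc (Num.max s x); rewrite /= in_itv/= le_max lexx ge_max sT xT => /(_ isT).
move=> /cvgrPdist_le gx; apply/cvgrPdist_le => /= e /gx/nbhs_ballP[d /= d0 dg].
apply/nbhs_ballP; exists d => // y; rewrite -ball_normE/= => xy.
rewrite in_itv/= => y0T; apply: dg; last exact: st.
by rewrite -ball_normE/= (le_lt_trans (clamp_dist _ _ _)).
Qed.

Lemma closed_dist (R : realType) (V : normedModType R) (S : set V) (l : V) :
  closed S -> (forall e : R, 0 < e -> exists2 x, S x & `|l - x| <= e) -> S l.
Proof.
move=> cS H; rewrite ((closure_id S).1 cS) => N /nbhs_ballP[e /= e0 eN].
have e2 : 0 < e / 2 by rewrite divr_gt0.
have [x Sx lx] := H _ e2.
by exists x; split=> //; apply: eN; rewrite -ball_normE/=; lra.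
Qed.

Lemma sum_norm_geometric (R : realType) (V : normedModType R) (u : nat -> V)
    (C : R) :
  (forall n, `|u n.+1 - u n| <= C / 2 ^+ n) ->
  forall n m, (n <= m)%N -> `|u m - u n| <= 2 * C / 2 ^+ n.
Proof.
move=> uC n m nm; have C0 : 0 <= C.
  by have := le_trans (normr_ge0 _) (uC 0%N); rewrite expr0 divr1.
have p2 k : 0 < (2 : R) ^+ k by rewrite exprn_gt0.
(* The subtracted tail makes the induction close: it drops by exactly [C / 2 ^+ (n + k)] at each
   step. *)
suff H k : `|u (n + k)%N - u n| <= 2 * C / 2 ^+ n - 2 * C / 2 ^+ (n + k).
  rewrite -(subnKC nm) (le_trans (H _))// gerBl.
  by apply: divr_ge0; [exact: mulr_ge0|exact/ltW/p2].
elim: k => [|k IH]; first by rewrite addn0 !subrr normr0.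
rewrite addnS -(subrK (u (n + k)%N) (u (n + k).+1)) -addrA.
rewrite (le_trans (ler_normD _ _))// (le_trans (lerD (uC _) IH))//.
have -> : 2 * C / 2 ^+ (n + k).+1 = C / 2 ^+ (n + k).
  by rewrite exprS invfM mulrACA divff ?mul1r.
by lra.
Qed.

Lemma cvg_geometric0 (R : realType) (C : R) : C / 2 ^+ n @[n --> \oo] --> (0 : R).
Proof.
rewrite -(mulr0 C); apply: cvgM; first exact: cvg_cst.
under eq_cvg do rewrite -exprVn.
by apply: cvg_expr; rewrite ger0_norm ?invr_ge0// invf_lt1// ltr1n.
Qed.

Lemma le_geometric0 (R : realType) (x C : R) :
  (forall n, x <= C / 2 ^+ n) -> x <= 0.
Proof.
move=> xC; apply/ler_addgt0Pr => e e0; rewrite add0r.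
have /cvgr0Pnorm_lt/(_ e e0)[N _ HN] := cvg_geometric0 C.
by rewrite (le_trans (xC N))// (le_trans (ler_norm _))// ltW// HN/=.
Qed.

Lemma derivative_within_bop (R : realType) (V W : normedModType R)
    (mu : bop V W) (J : set R) (g : R -> V) (h : R -> W) (r : R) (l : V) :
  J r -> (forall q, J q -> h q = mu (g q)) -> derivative_within J g r l ->
  derivative_within J h r (mu l).
Proof.
move=> Jr hg /derivative_withinP gl; apply/derivative_withinP => e e0.
have k1 : 0 < `|mu| + 1 by rewrite ltr_wpDl.
have [d d0 dg] := gl _ (divr_gt0 e0 k1); exists d => // q Jq qr.
have -> : h q - h r - (q - r) *: mu l = mu (g q - g r - (q - r) *: l).
  by rewrite !hg// !bopB bopZ.
rewrite (le_trans (opnormP _ _))//.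
rewrite (le_trans (ler_wpM2l (opnorm_ge0 _) (dg q Jq qr)))//.
rewrite mulrA ler_wpM2r// mulrCA ler_piMr ?(ltW e0)//.
by rewrite ler_pdivrMr// mul1r lerDl.
Qed.

Lemma weak_solution_ext (R : realType) (D B : normedModType R)
    (iota : bop D B) (s T : R) (L L' : R -> bop D B) (m m' : R -> dual B) :
  (forall r, s <= r <= T -> L r = L' r) ->
  (forall r, s <= r <= T -> m r = m' r) ->
  weak_solution iota s T L m -> weak_solution iota s T L' m'.
Proof.
move=> LL mm msol f r rsT; rewrite -LL// -mm//.
have /derivative_withinP dm := msol f r rsT.
apply/derivative_withinP => e /dm[d d0 dg].
exists d => // q qsT qr; rewrite -!mm//; exact: dg.
Qed.

(** The time derivative of [m q (iota f)] is at most [K * c * |f|], so the mean value inequality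
    applies with a linear majorant. This is the source of all continuity in time of iterates and
    solutions. *)
Lemma weak_solution_lipschitz (R : realType) (D B : normedModType R)
    (iota : bop D B) (s T K c : R) (L : R -> bop D B) (m : R -> dual B) :
  (forall q, s <= q <= T -> `|m q| <= K) ->
  (forall q, s <= q <= T -> `|L q| <= c) ->
  weak_solution iota s T L m ->
  forall t t', s <= t <= T -> s <= t' <= T ->
    `|adjoint iota (m t - m t')| <= K * c * `|t - t'|.
Proof.
move=> mK Lc msol.
suff H t t' : s <= t' -> t' <= t -> t <= T ->
    `|adjoint iota (m t - m t')| <= K * c * `|t - t'|.
  move=> t t' /andP[st tT] /andP[st' t'T].
  have [tt'|/ltW tt'] := leP t' t; first exact: H.
  by rewrite adjointB distrC -adjointB distrC; exact: H.
move=> st' t't tT.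
have stT q : t' <= q <= t -> s <= q <= T.
  by move=> /andP[? ?]; apply/andP; split; lra.
have st'T : s <= t' <= T by apply: stT; rewrite lexx.
have K0 : 0 <= K by apply: le_trans (mK _ st'T).
have c0 : 0 <= c by apply: le_trans (Lc _ st'T).
apply: bop_norm_le => [|f]; first by rewrite !mulr_ge0.
have -> : K * c * `|t - t'| * `|f| = K * c * `|f| * t - K * c * `|f| * t'.
  by rewrite ger0_norm ?subr_ge0//; ring.
apply: (@mean_value_bound R (fun q => m q (iota f)) (fun q => m q (L q f))
  (fun q => K * c * `|f| * q) (fun=> K * c * `|f|) t' t t't).
- move=> r rt; apply: derivative_within_subset (msol f r (stT _ rt)).
  by move=> q /=; rewrite !in_itv/=; exact: stT.
- by move=> r; apply: is_derive_eq; rewrite /GRing.scale/= ?mulr1.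
- move=> r /andP[/ltW r1 /ltW r2]; have rt : t' <= r <= t by rewrite r1.
  rewrite (le_trans (opnormP _ _))// -mulrA ler_pM ?mK ?stT//; first exact: opnorm_ge0.
  by rewrite (le_trans (opnormP _ _))// ler_wpM2r// Lc// stT.
Qed.

Lemma adjoint_norm (R : realType) (V W : normedModType R) (U : bop V W)
    (x : dual W) :
  `|adjoint U x| <= `|x| * `|U|.
Proof.
apply: bop_norm_le => [|f]; first exact: mulr_ge0.
by rewrite (le_trans (opnormP x (U f)))// -mulrA ler_wpM2l ?opnorm_ge0// opnormP.
Qed.

Lemma is_derive_expR_affine (R : realType) (c a s r : R) :
  is_derive r 1 (fun q => c * expR (a * (q - s)) : R^o)
    (c * (a * expR (a * (r - s)))).
Proof.
have ga : is_derive r 1 (fun q : R => a * (q - s)) a.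
  by apply: is_derive_eq; rewrite /GRing.scale/= subr0 !mulr1.
have := is_deriveZ c (is_derive1_comp (is_derive_expR _) ga).
by rewrite [expR _ * a]mulrC.
Qed.

Lemma dist_le_perturb (R : realType) (V : normedModType R) (x x' y y' : V)
    (a a' b : R) :
  `|x - y| <= a -> `|x' - y'| <= a' -> `|y - y'| <= b ->
  `|x - x'| <= b + (a + a').
Proof.
move=> xy xy' yy'.
have -> : x - x' = (x - y) + (y - y') - (x' - y') by rewrite opprB !subrKA.
apply: le_trans (ler_normB _ _) _; have := ler_normD (x - y) (y - y'); lra.
Qed.

(** * The nonlinear equation *)

Section nonlinear_evolution.
Context (R : realType) (B D : completeNormedModType R) (iota : bop D B)
  (iota_dense : dense (range iota)) (M : set (dual B)) (M0 : R)
  (M_convex : convex_set (M : set (convex_lmodType (dual B))))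
  (M_bounded : forall mu, M mu -> `|mu| <= M0)
  (M_closedD : closed (adjoint iota @` M))
  (T : R) (A : R -> dual B -> bop D B)
  (c1 c2 c3 : R) (c1_gt0 : 0 < c1) (c2_gt0 : 0 < c2)
  (A_lipschitz : forall mu, M mu -> forall xi eta,
     curves iota T M mu xi -> curves iota T M mu eta ->
     (sup_norm T (fun t => (A t (xi t) - A t (eta t))%R) <=
        c1%:E * sup_norm T (fun t => adjoint iota (xi t - eta t)%R))%E /\
     (sup_norm T (fun t => A t (xi t)) <= c1%:E)%E)
  (A_generates : forall mu, M mu -> forall xi, curves iota T M mu xi ->
     exists (U : R -> R -> bop B B) (UD : R -> R -> bop D D),
       generates iota T (fun t => A t (xi t)) U UD /\
       forall t s : R, 0 <= t -> t <= s -> s <= T ->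
         [/\ `|UD t s| <= c2, `|U t s| <= c3
           & forall nu, M nu -> M (adjoint (U t s) nu)]).

(** * Curves in [M], pointwise bounds on the coefficients, comparison of evolutions *)

Lemma sup_norm_ub (V : normedModType R) (g : R -> V) (t : R) :
  0 <= t <= T -> (`|g t|%:E <= sup_norm T g)%E.
Proof.
by move=> t0T; apply: ereal_sup_ubound; exists t => //; rewrite /= in_itv.
Qed.

Lemma sup_norm_le (V : normedModType R) (g : R -> V) (k : R) :
  (forall t, 0 <= t <= T -> `|g t| <= k) -> (sup_norm T g <= k%:E)%E.
Proof.
move=> gk; apply: ge_ereal_sup => _ [t /= t0T <-]; by rewrite lee_fin gk.
Qed.

Lemma lipschitz_curve (mu : dual B) (xi : R -> dual B) (k : R) :
  xi 0 = mu -> (forall t, 0 <= t <= T -> M (xi t)) ->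
  (forall t t', 0 <= t <= T -> 0 <= t' <= T ->
    `|adjoint iota (xi t - xi t')| <= k * `|t - t'|) ->
  curves iota T M mu xi.
Proof.
move=> xi0 Mxi xik; split=> // [t t0 tT|]; first by apply: Mxi; rewrite t0.
apply: (@lipschitz_within_continuous _ _ _ _ k) => x y /=.
by rewrite !in_itv/= -adjointB; exact: xik.
Qed.

Lemma cst_curve (mu : dual B) : M mu -> curves iota T M mu (fun=> mu).
Proof.
move=> Mmu; apply: (@lipschitz_curve _ _ 0) => // t t' _ _.
by rewrite adjointB subrr normr0 mul0r.
Qed.

Lemma convex_combination (mu nu : dual B) (k : R) :
  M mu -> M nu -> 0 <= k -> k <= 1 -> M (k *: mu + (1 - k) *: nu).
Proof.
move=> Mmu Mnu k0 k1.
by have := M_convex (Itv01 k0 k1) (mem_set Mmu) (mem_set Mnu); rewrite inE.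
Qed.

Lemma coefficient_bound (t : R) (mu : dual B) :
  0 <= t <= T -> M mu -> `|A t mu| <= c1.
Proof.
move=> t0T Mmu; have cmu := cst_curve Mmu.
have [_ H] := A_lipschitz Mmu cmu cmu.
by rewrite -lee_fin; apply: le_trans H; exact: (sup_norm_ub (fun t => A t mu)).
Qed.

(* At a time [t > 0] any two points of [M] lie on curves with a common starting
   point, by convexity; at [t = 0] the hypothesis compares nothing. *)
Lemma coefficient_lipschitz (t : R) (mu nu : dual B) :
  0 < t -> t <= T -> M mu -> M nu ->
  `|A t mu - A t nu| <= c1 * `|adjoint iota (mu - nu)|.
Proof.
move=> t0 tT Mmu Mnu.
(* The ramp [k] leads [xi] along the segment from [mu] at time 0 to [nu] at time [t], where it
   stays. It is compared with the constant curve [mu]. *)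
pose k (q : R) := Num.min (q / t) 1.
pose xi q : dual B := k q *: nu + (1 - k q) *: mu.
have kE q q' : `|k q - k q'| <= t^-1 * `|q - q'|.
  rewrite -[t^-1]gtr0_norm ?invr_gt0// -normrM mulrC mulrBl /k.
  rewrite /Num.min; case: ltP => h; case: ltP => h'; rewrite ?subrr ?normr0//.
  - by rewrite !ler0_norm; lra.
  - by rewrite !ger0_norm; lra.
have xiE q q' : adjoint iota (xi q - xi q') =
    (k q - k q') *: adjoint iota (nu - mu).
  apply: bopP => f.
  change (k q * nu (iota f) + (1 - k q) * mu (iota f) -
    (k q' * nu (iota f) + (1 - k q') * mu (iota f)) =
    (k q - k q') * (nu (iota f) - mu (iota f))).
  ring.
have k01 q : 0 <= q <= T -> 0 <= k q <= 1.
  move=> /andP[q0 _]; rewrite /k le_min ler01 ge_min lexx orbT !andbT.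
  by rewrite divr_ge0// ltW.
have k0 : k 0 = 0 by rewrite /k mul0r min_l.
have xi0 : xi 0 = mu by rewrite /xi k0 subr0 scale0r scale1r add0r.
have cxi : curves iota T M mu xi.
  apply: (@lipschitz_curve _ _ (t^-1 * `|adjoint iota (nu - mu)|)) => // q.
    by move=> /k01/andP[? ?]; exact: convex_combination.
  by move=> q' _ _; rewrite xiE normrZ mulrAC ler_wpM2r.
have [+ _] := A_lipschitz Mmu (cst_curve Mmu) cxi.
move=> /(le_trans (sup_norm_ub (fun t => A t mu - A t (xi t)) (t := t) _)).
have kt : k t = 1 by rewrite /k divff ?gt_eqF// min_r.
rewrite (ltW t0) tT /xi kt subrr scale1r scale0r addr0 -/xi => /(_ isT).
rewrite -lee_fin EFinM => /le_trans; apply.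
(* Since [k q <= 1], the two curves are never further apart than [mu] and [nu]. *)
rewrite lee_pmul2l//; apply: sup_norm_le => q q0T.
rewrite -[X in X - _]xi0 xiE k0 sub0r normrZ normrN adjointB distrC -adjointB.
by have /andP[q0 q1] := k01 q q0T; rewrite ger0_norm// ler_piMl.
Qed.

(** [M0] bounds the points of [M], [c1] is the Lipschitz constant of the coefficients, [c2] bounds
    the propagators on [D]; the 2 produces the contraction factor 1/2. *)
Let rate := 2 * M0 * c1 * c2.

(* Weighting time by [expR (rate * (r - s))] turns the Gronwall-type integral
   inequality into a contraction with factor 1/2. *)
Lemma evolution_compare (s rho : R) (mu : dual B) (xi eta m m' : R -> dual B) :
  0 <= s -> 0 <= rho -> M mu -> curves iota T M mu eta ->
  (forall r, s <= r <= T -> [/\ M (xi r), M (m r) & M (m' r)]) ->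
  weak_solution iota s T (fun r => A r (xi r)) m ->
  weak_solution iota s T (fun r => A r (eta r)) m' ->
  (forall r, s <= r <= T ->
    `|adjoint iota (xi r - eta r)| <= rho * expR (rate * (r - s))) ->
  forall t, s <= t <= T -> `|adjoint iota (m t - m' t)| <=
    rho / 2 * expR (rate * (t - s)) + c2 * `|adjoint iota (m s - m' s)|.
Proof.
move=> s0 rho0 Mmu ceta Mm msol m'sol xieta t /andP[st tT].
have M00 : 0 <= M0 by apply: le_trans (M_bounded Mmu).
have [V [VD [gen bnd]]] := A_generates Mmu ceta.
have mK r : s <= r <= T -> `|m r| <= M0 by move=> /Mm[_ /M_bounded].
have m'K r : s <= r <= T -> `|m' r| <= M0 by move=> /Mm[_ _ /M_bounded].
have Meta r : 0 <= r -> r <= T -> M (eta r) by have [_ + _] := ceta; apply.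
apply: bop_norm_le => [|f].
  by rewrite addr_ge0 ?mulr_ge0 ?divr_ge0 ?expR_ge0// ltW.
have VDf r : s <= r -> r <= t -> `|VD r t f| <= c2 * `|f|.
  move=> sr rt; have [VDc _ _] := bnd r t (le_trans s0 sr) rt tT.
  by rewrite (le_trans (opnormP _ _))// ler_wpM2r.
have h1 : `|m t (iota f) - m s (V s t (iota f))| <=
    rho / 2 * expR (rate * (t - s)) * `|f|.
  (* As [rate / 2 = M0 * c1 * c2], the derivative of [phi] is exactly the product of the bounds on
     [m r], on the difference of coefficients and on [VD r t f]. *)
  pose phi (r : R) : R^o := rho / 2 * `|f| * expR (rate * (r - s)).
  pose dphi (r : R) : R^o := rho / 2 * `|f| * (rate * expR (rate * (r - s))).
  have phid (r : R) : is_derive r 1 phi (dphi r) by exact: is_derive_expR_affine.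
  have phi_s : 0 <= phi s by rewrite !mulr_ge0 ?divr_ge0 ?expR_ge0.
  rewrite [leRHS]mulrAC; apply: (@le_trans _ _ (phi t - phi s)); last first.
    by rewrite gerBl.
  apply: (weak_solution_compare iota_dense s0 st tT mK msol gen phid).
  move=> r /andP[sr rt].
  have rsT : s <= r <= T by rewrite (ltW sr) ltW// (lt_le_trans rt).
  have [Mxi Mmr _] := Mm r rsT.
  (* Strict positivity, needed to compare coefficients, holds even for [s = 0] because [r] is
     interior. *)
  have r0 : 0 < r by exact: le_lt_trans sr.
  have rT : r <= T by have /andP[] := rsT.
  rewrite (le_trans (opnormP _ _))//.
  have -> : dphi r = M0 * ((c1 * (rho * expR (rate * (r - s)))) * (c2 * `|f|)).
    by rewrite /dphi /rate; field.
  rewrite ler_pM ?opnorm_ge0//; first exact: mK.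
  rewrite (le_trans (opnormP _ _))// ler_pM ?opnorm_ge0 ?VDf ?(ltW sr) ?(ltW rt)//.
  rewrite (le_trans (coefficient_lipschitz r0 rT Mxi (Meta _ (ltW r0) rT)))//.
  by rewrite ler_wpM2l ?(ltW c1_gt0)// xieta.
(* [m'] solves the very equation whose coefficients generate [V], so the defect vanishes and the
   zero majorant suffices. *)
have h2 : `|m' t (iota f) - m' s (V s t (iota f))| <= 0.
  have := @weak_solution_compare _ _ _ _ _ _ _ _ _ _ _ _ _ (fun=> 0) (fun=> 0) f
    iota_dense s0 st tT m'K m'sol gen.
  rewrite subrr; apply=> r rst.
  by rewrite subrr linear0 normr0.
have h3 : `|(m s - m' s) (V s t (iota f))| <= c2 * `|adjoint iota (m s - m' s)| * `|f|.
  have [_ _ _ VDV _] := gen; rewrite -VDV//.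
  rewrite (le_trans (opnormP (adjoint iota (m s - m' s)) (VD s t f)))//.
  by rewrite (mulrC c2) -mulrA ler_wpM2l ?opnorm_ge0// VDf.
have -> : adjoint iota (m t - m' t) f =
    (m t (iota f) - m s (V s t (iota f))) + (m s - m' s) (V s t (iota f)) -
    (m' t (iota f) - m' s (V s t (iota f))).
  by rewrite adjointB !bop_subE /=; ring.
rewrite (le_trans (ler_normB _ _))// (le_trans (lerD (ler_normD _ _) (lexx _)))//.
by apply: le_trans (lerD (lerD h1 h3) h2) _; rewrite addr0 mulrDl.
Qed.

(** The curve lives on all of [[0, T]] and takes the value [mu] at 0 as well as at [s], so that the
    assumptions on [A] apply to it; the equation is imposed only from [s] on. *)
Definition nonlinear_solution (s : R) (mu : dual B) (m : R -> dual B) :=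
  [/\ curves iota T M mu m, m s = mu &
      weak_solution iota s T (fun r => A r (m r)) m].

(** * Stability and uniqueness for the nonlinear equation *)

Let M0_ge0 mu : M mu -> 0 <= M0.
Proof. by move=> /M_bounded; exact: le_trans. Qed.

Let M_dist x y : M x -> M y -> `|adjoint iota (x - y)| <= 2 * M0 * `|iota|.
Proof.
move=> /M_bounded Mx /M_bounded My; rewrite (le_trans (adjoint_norm _ _))//.
by rewrite ler_wpM2r// (le_trans (ler_normB _ _))//; lra.
Qed.

Let weight_ge1 mu s r : M mu -> s <= r -> 1 <= expR (rate * (r - s)).
Proof.
move=> Mmu sr; rewrite -expR0 ler_expR /rate.
by rewrite !mulr_ge0 ?(M0_ge0 Mmu) ?(ltW c1_gt0) ?(ltW c2_gt0) ?subr_ge0.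
Qed.

Let curve_mem mu m r : curves iota T M mu m -> 0 <= r <= T -> M (m r).
Proof. by move=> [_ + _] /andP[r0 rT]; apply. Qed.

Let adjoint_dist0 x y : `|adjoint iota (x - y)| <= 0 -> x = y.
Proof.
rewrite normr_le0 adjointB subr_eq0 => /eqP; exact: adjoint_inj.
Qed.

(** Let each solution drive its own equation in [evolution_compare]. The supremum [S] of the
    weighted distance then satisfies [S <= S / 2 + c2 * |mu - eta|], and it is finite because [M] is
    bounded, so the half can be absorbed. *)
Lemma nonlinear_stability (s : R) (mu eta : dual B) (m m' : R -> dual B) :
  0 <= s -> s <= T -> M mu -> M eta ->
  nonlinear_solution s mu m -> nonlinear_solution s eta m' ->
  forall t, s <= t <= T -> `|adjoint iota (m t - m' t)| <=
    2 * c2 * expR (rate * (t - s)) * `|adjoint iota (mu - eta)|.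
Proof.
move=> s0 sT Mmu Meta [cm ms msol] [cm' m's m'sol].
have st0 r : s <= r <= T -> 0 <= r <= T.
  by move=> /andP[sr ->]; rewrite (le_trans s0).
have Mm r : s <= r <= T -> [/\ M (m r), M (m r) & M (m' r)].
  by move=> /st0 rT; split; apply: curve_mem rT; [exact: cm|exact: cm|exact: cm'].
pose e r := expR (rate * (r - s)).
have e0 r : 0 < e r by exact: expR_gt0.
pose d r := `|adjoint iota (m r - m' r)| / e r.
pose S := [set d r | r in `[s, T]].
have S0 : S !=set0 by exists (d s), s => //=; rewrite in_itv/= lexx sT.
have Sub : has_ubound S.
  exists (2 * M0 * `|iota|) => _ [r /= + <-]; rewrite in_itv/= => rsT.
  have [Mmr _ Mm'r] := Mm r rsT; have /andP[sr _] := rsT.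
  rewrite /d ler_pdivrMr// (le_trans (M_dist Mmr Mm'r))// ler_peMr//.
    by rewrite !mulr_ge0// (M0_ge0 Mmu).
  exact: weight_ge1 Mmu sr.
have dS r : s <= r <= T -> d r <= sup S.
  by move=> rsT; apply: ub_le_sup => //; exists r => //=; rewrite in_itv.
have supS : 0 <= sup S.
  by rewrite (le_trans _ (dS s _)) ?lexx ?sT// divr_ge0// ltW.
have cmp := evolution_compare s0 supS Meta cm' Mm msol m'sol _.
have supS_le : sup S <= sup S / 2 + c2 * `|adjoint iota (mu - eta)|.
  apply: ge_sup => // _ [r /= + <-]; rewrite in_itv/= => rsT.
  rewrite ler_pdivrMr// mulrDl -ms -m's.
  apply: le_trans (cmp _ r rsT) _.
    by move=> q qsT; have := dS q qsT; rewrite ler_pdivrMr.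
  rewrite lerD2l ler_peMr// ?mulr_ge0 ?(ltW c2_gt0)//.
  by apply: weight_ge1 Mmu _; have /andP[] := rsT.
move=> t tsT; have := dS t tsT; rewrite ler_pdivrMr// => /le_trans; apply.
by rewrite mulrAC ler_pM2r//; lra.
Qed.

Lemma nonlinear_unique (s : R) (mu : dual B) (m m' : R -> dual B) :
  0 <= s -> s <= T -> M mu ->
  nonlinear_solution s mu m -> nonlinear_solution s mu m' ->
  forall t, s <= t <= T -> m t = m' t.
Proof.
move=> s0 sT Mmu msol m'sol t tsT; apply: adjoint_dist0.
apply: le_trans (nonlinear_stability s0 sT Mmu Mmu msol m'sol tsT) _.
by rewrite subrr (_ : adjoint iota 0 = 0) ?normr0 ?mulr0//; exact: bopP.
Qed.

(** * Passage between solutions on [[s, T]] and curves on [[0, T]] *)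

Lemma cauchy_nonlinear (s : R) (mu : dual B) (m : R -> dual B) :
  0 <= s -> s <= T -> cauchy_solution iota T M A s mu m ->
  nonlinear_solution s mu (fun t => m (Num.max s t)).
Proof.
move=> s0 sT [ms Mm cm dm]; split.
- split; first by rewrite max_l.
    move=> t t0 tT; have /andP[? ?] : s <= Num.max s t <= T.
      by apply: clamp_itv; rewrite ?t0.
    exact: Mm.
  exact: (@within_continuous_clamp _ _ s T (fun t => adjoint iota (m t))).
- by rewrite max_l.
- apply: (@weak_solution_ext _ _ _ _ _ _ (fun r => A r (m r)) _ m).
  + by move=> r /andP[sr _]; rewrite max_r.
  + by move=> r /andP[sr _]; rewrite max_r.
  + by move=> f r /andP[sr rT]; exact: dm.
Qed.

Lemma nonlinear_cauchy (s : R) (mu : dual B) (m : R -> dual B) :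
  0 <= s -> nonlinear_solution s mu m -> cauchy_solution iota T M A s mu m.
Proof.
move=> s0 [[_ Mm cm] ms msol]; split=> //.
- by move=> t st tT; apply: Mm => //; exact: le_trans st.
- apply: continuous_subspaceW cm => t /=.
  by rewrite !in_itv/= => /andP[st ->]; rewrite (le_trans s0).
- by move=> f t st tT; apply: msol; rewrite st.
Qed.

(** * Existence by Picard iteration *)

Lemma clamped_curve_lipschitz (s : R) (mu : dual B) (xi zeta : R -> dual B) :
  0 <= s -> s <= T -> curves iota T M mu xi ->
  (forall q, zeta q = zeta (Num.max s q)) ->
  (forall q, s <= q <= T -> M (zeta q)) ->
  weak_solution iota s T (fun r => A r (xi r)) zeta ->
  forall q q', 0 <= q <= T -> 0 <= q' <= T ->
    `|adjoint iota (zeta q - zeta q')| <= M0 * c1 * `|q - q'|.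
Proof.
move=> s0 sT cxi zeta_clamp Mzeta zsol q q' qT q'T.
have qs := clamp_itv sT qT; have q's := clamp_itv sT q'T.
rewrite (zeta_clamp q) (zeta_clamp q').
have zM r : s <= r <= T -> `|zeta r| <= M0 by move=> /Mzeta/M_bounded.
have Ac r : s <= r <= T -> `|A r (xi r)| <= c1.
  move=> /andP[sr rT]; have r0T : 0 <= r <= T by rewrite rT (le_trans s0).
  by apply: coefficient_bound => //; exact: curve_mem cxi _.
apply: le_trans (weak_solution_lipschitz zM Ac zsol qs q's) _.
by rewrite ler_wpM2l ?clamp_dist// mulr_ge0 ?(M0_ge0 (Mzeta _ qs)) ?ltW.
Qed.

(** The solution is the dual propagator applied to [mu], frozen before [s]: pairing [mu] with the
    derivative of [U s q (iota f)] in [q] gives the equation, and invariance of [M] keeps the curve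
    inside. *)
Lemma picard_step (s : R) (mu : dual B) (xi : R -> dual B) :
  0 <= s -> s <= T -> M mu -> curves iota T M mu xi ->
  exists zeta : R -> dual B,
    [/\ curves iota T M mu zeta, zeta s = mu &
        weak_solution iota s T (fun r => A r (xi r)) zeta].
Proof.
move=> s0 sT Mmu cxi; have [U [UD [gen bnd]]] := A_generates Mmu cxi.
have [[_ Uid _] _ _ _ dU] := gen.
pose zeta q := adjoint (U s (Num.max s q)) mu.
have zetaC q : zeta q = zeta (Num.max s q) by rewrite /zeta maxA maxxx.
have zs : zeta s = mu.
  by apply: bopP => b; rewrite /zeta maxxx /= Uid.
have Mz q : s <= q <= T -> M (zeta q).
  move=> /andP[sq qT]; have [_ _ MU] := bnd s q s0 sq qT.
  by rewrite /zeta max_r//; exact: MU.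
have zsol : weak_solution iota s T (fun r => A r (xi r)) zeta.
  move=> f r /andP[sr rT]; have [dUf _] := dU s r T s0 sr rT (lexx _) f.
  rewrite [zeta r]/zeta max_r//=.
  apply: derivative_within_bop dUf; first by rewrite /= in_itv/= sr.
  by move=> q; rewrite /= in_itv/= => /andP[sq _]; rewrite /zeta max_r.
exists zeta; split=> //.
apply: (@lipschitz_curve _ _ (M0 * c1)).
- by rewrite zetaC max_l.
- by move=> t tT; rewrite zetaC; apply: Mz; exact: clamp_itv.
- exact: clamped_curve_lipschitz cxi zetaC Mz zsol.
Qed.

Lemma nonlinear_exists (s : R) (mu : dual B) :
  0 <= s -> s <= T -> M mu -> exists m, nonlinear_solution s mu m.
Proof.
move=> s0 sT Mmu.
(* [Phi] is the Picard map, made total by an arbitrary value on functions that are not admissible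
   curves. *)
have /choice[Phi PhiP] : forall xi : R -> dual B, exists zeta : R -> dual B,
    curves iota T M mu xi ->
      [/\ curves iota T M mu zeta, zeta s = mu &
          weak_solution iota s T (fun r => A r (xi r)) zeta].
  move=> xi; have [cxi|ncxi] := pselect (curves iota T M mu xi).
    by have [zeta] := picard_step s0 sT Mmu cxi; exists zeta.
  by exists xi.
pose u n := iter n Phi (fun=> mu).
have uc n : curves iota T M mu (u n).
  by elim: n => [|n /PhiP[]//]; exact: cst_curve.
have us n : u n s = mu by case: n => // n; have [] := PhiP _ (uc n).
have usol n : weak_solution iota s T (fun r => A r (u n r)) (u n.+1).
  by have [] := PhiP _ (uc n).
have st0 r : s <= r <= T -> 0 <= r <= T.
  by move=> /andP[sr ->]; rewrite (le_trans s0).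
have Mu n r : s <= r <= T -> M (u n r) by move=> /st0; exact: curve_mem.
pose e r := expR (rate * (r - s)).
have e0 r : 0 < e r by exact: expR_gt0.
(* [b] bounds the diameter of [M] in the norm of the dual of [D], hence the first Picard
   increment. *)
pose b := 2 * M0 * `|iota|.
have b0 : 0 <= b by rewrite !mulr_ge0// (M0_ge0 Mmu).
have bn n : 0 <= b / 2 ^+ n by rewrite divr_ge0// exprn_ge0.
have dist0 : c2 * `|adjoint iota (mu - mu)| = 0.
  by rewrite adjointB subrr normr0 mulr0.
(* Each comparison halves the weighted distance; the term from the initial data vanishes since all
   iterates equal [mu] at [s]. *)
have du n r : s <= r <= T -> `|adjoint iota (u n.+1 r - u n r)| <= b / 2 ^+ n * e r.
  elim: n r => [|n IH] r rsT.
    rewrite expr0 divr1 (le_trans (M_dist (Mu _ _ rsT) (Mu _ _ rsT)))//.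
    by rewrite ler_peMr//; apply: weight_ge1 Mmu _; have /andP[] := rsT.
  have Mr q : s <= q <= T -> [/\ M (u n.+1 q), M (u n.+2 q) & M (u n.+1 q)].
    by move=> qsT; split; exact: Mu.
  have := evolution_compare s0 (bn n) Mmu (uc n) Mr (usol n.+1) (usol n) IH rsT.
  by rewrite !us dist0 addr0 exprSr invfM mulrA.
(* At each time the restrictions to [D] converge in the dual of [D]; closedness of the image of [M]
   there lifts the limit to a point of [M]. *)
have /choice[nu nuP] : forall r, exists v : dual B, s <= r <= T ->
    M v /\ forall n, `|adjoint iota (v - u n r)| <= 2 * (b * e r) / 2 ^+ n.
  move=> r; have [rsT|] := boolP (s <= r <= T); last by exists mu.
  have /sum_norm_geometric H n : `|adjoint iota (u n.+1 r) - adjoint iota (u n r)|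
      <= b * e r / 2 ^+ n by rewrite -adjointB mulrAC du.
  have [l lu] := bop_complete H (@cvg_geometric0 _ _).
  have [v Mv vl] : (adjoint iota @` M) l.
    apply: closed_dist M_closedD _ => d d0.
    have /cvgr0Pnorm_lt/(_ d d0)[N _ HN] := cvg_geometric0 (2 * (b * e r)).
    exists (adjoint iota (u N r)); first by exists (u N r) => //; exact: Mu.
    by rewrite (le_trans (lu N))// (le_trans (ler_norm _))// ltW// HN/=.
  by exists v => _; split=> // n; rewrite adjointB vl.
pose xi q := nu (Num.max s q).
have xiC q : xi q = xi (Num.max s q) by rewrite /xi maxA maxxx.
have Mxi q : s <= q <= T -> M (xi q).
  by move=> /[dup] qsT /andP[sq _]; rewrite /xi max_r//; have [] := nuP q qsT.
have xiu r n : s <= r <= T ->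
    `|adjoint iota (xi r - u n r)| <= 2 * (b * e r) / 2 ^+ n.
  by move=> /[dup] rsT /andP[sr _]; rewrite /xi max_r//; have [_] := nuP r rsT.
have ssT : s <= s <= T by rewrite lexx.
have xis : xi s = mu.
  apply: adjoint_dist0; apply: (@le_geometric0 _ _ (2 * (b * e s))) => n.
  by rewrite -{1}(us n); exact: xiu.
have M0c1 : 0 <= M0 * c1 by rewrite mulr_ge0 ?(M0_ge0 Mmu)// ltW.
have uL n r r' : s <= r <= T -> s <= r' <= T ->
    `|adjoint iota (u n r - u n r')| <= M0 * c1 * `|r - r'|.
  case: n => [|n] rsT r'sT.
    by rewrite adjointB subrr normr0 mulr_ge0.
  apply: (weak_solution_lipschitz _ _ (usol n) rsT r'sT) => q /[dup] qsT /st0 q0T.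
    exact/M_bounded/Mu.
  by apply: coefficient_bound => //; exact: Mu.
(* The Lipschitz constant is common to all iterates and passes to the limit, so the limit is an
   admissible curve. *)
have xiL r r' : s <= r <= T -> s <= r' <= T ->
    `|adjoint iota (xi r - xi r')| <= M0 * c1 * `|r - r'|.
  move=> rsT r'sT; rewrite -subr_le0.
  apply: (@le_geometric0 _ _ (2 * (b * e r) + 2 * (b * e r'))) => n.
  rewrite lerBlDl [(_ + _) / _]mulrDl adjointB.
  apply: (@dist_le_perturb _ _ _ _ (adjoint iota (u n r)) (adjoint iota (u n r')));
    rewrite -adjointB; [exact: xiu|exact: xiu|exact: uL].
have cxi : curves iota T M mu xi.
  apply: (@lipschitz_curve _ _ (M0 * c1)).
  - by rewrite xiC max_l.
  - by move=> q q0T; rewrite xiC; apply: Mxi; exact: clamp_itv.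
  - move=> q q' q0T q'0T; rewrite xiC (xiC q').
    rewrite (le_trans (xiL _ _ (clamp_itv sT q0T) (clamp_itv sT q'0T)))//.
    by rewrite ler_wpM2l// clamp_dist.
have [czeta zetas zetasol] := PhiP _ cxi.
(* Both sides are limits of the iterates: [Phi xi] is driven by [xi] and [u n.+1] by [u n], which
   approaches [xi] geometrically. *)
have zeta_xi r : s <= r <= T -> Phi xi r = xi r.
  move=> rsT; apply: adjoint_dist0.
  apply: (@le_geometric0 _ _ (2 * (b * e r))) => n.
  have rho0 : 0 <= 2 * (b / 2 ^+ n) by rewrite mulr_ge0.
  have Mr q : s <= q <= T -> [/\ M (xi q), M (Phi xi q) & M (u n.+1 q)].
    by move=> qsT; split; [exact: Mxi|exact: curve_mem czeta (st0 _ qsT)|exact: Mu].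
  have xiun q : s <= q <= T ->
      `|adjoint iota (xi q - u n q)| <= 2 * (b / 2 ^+ n) * expR (rate * (q - s)).
    move=> qsT; apply: le_trans (xiu q n qsT) _.
    by rewrite le_eqVlt /e; apply/orP; left; apply/eqP; ring.
  have := evolution_compare s0 rho0 Mmu (uc n) Mr zetasol (usol n) xiun rsT.
  have := xiu r n.+1 rsT; rewrite zetas us dist0 addr0 !adjointB -/(e r).
  have -> : 2 * (b * e r) / 2 ^+ n.+1 = b * e r / 2 ^+ n.
    by rewrite exprS invfM mulrACA divff ?mul1r.
  have -> : 2 * (b / 2 ^+ n) / 2 * e r = b * e r / 2 ^+ n.
    by rewrite [2 * _]mulrC mulfK// mulrAC.
  have -> : 2 * (b * e r) / 2 ^+ n = b * e r / 2 ^+ n + b * e r / 2 ^+ n.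
    by rewrite -mulrDl -mulr2n mulr_natl.
  rewrite distrC => hx hz.
  rewrite -[adjoint iota (Phi xi r)](subrK (adjoint iota (u n.+1 r))).
  by rewrite -addrA; apply: le_trans (ler_normD _ _) (lerD hz hx).
exists (Phi xi); split=> //.
by apply: weak_solution_ext zetasol => // r /zeta_xi ->.
Qed.
End nonlinear_evolution.

(** * Assembling the propagator *)

Lemma cauchy_solution_restrict (R : realType) (B D : normedModType R)
    (iota : bop D B) (T : R) (M : set (dual B)) (A : R -> dual B -> bop D B)
    (r s : R) (mu : dual B) (m : R -> dual B) :
  r <= s -> cauchy_solution iota T M A r mu m ->
  cauchy_solution iota T M A s (m s) m.
Proof.
move=> rs [_ Mm cm dm].
have sub : `[s, T]%classic `<=` `[r, T]%classic.
  by move=> q /=; rewrite !in_itv/= => /andP[sq ->]; rewrite (le_trans rs).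
split=> // [t st tT||f t st tT].
- by apply: Mm => //; exact: le_trans st.
- exact: continuous_subspaceW cm.
- by apply: (derivative_within_subset sub); apply: dm => //; exact: le_trans st.
Qed.

Theorem theorem2p2 (R : realType) (B D : completeNormedModType R)
    (iota : bop D B)
    (iota_inj : injective iota)
    (iota_dense : dense (range iota))
    (iota_norm : forall f : D, `|iota f| <= `|f|)
    (M : set (dual B)) (M0 : R)
    (M_convex : convex_set (M : set (convex_lmodType (dual B))))
    (M_bounded : forall mu, M mu -> `|mu| <= M0)
    (M_closed : closed M)
    (M_closedD : closed (adjoint iota @` M))
    (T : R) (T_gt0 : 0 < T)
    (A : R -> dual B -> bop D B)
    (c1 c2 c3 : R) (c1_gt0 : 0 < c1) (c2_gt0 : 0 < c2) (c3_gt0 : 0 < c3)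
    (A_lipschitz : forall mu, M mu -> forall xi eta,
       curves iota T M mu xi -> curves iota T M mu eta ->
       (sup_norm T (fun t => (A t (xi t) - A t (eta t))%R) <=
          c1%:E * sup_norm T (fun t => adjoint iota (xi t - eta t)%R))%E /\
       (sup_norm T (fun t => A t (xi t)) <= c1%:E)%E)
    (A_generates : forall mu, M mu -> forall xi, curves iota T M mu xi ->
       exists (U : R -> R -> bop B B) (UD : R -> R -> bop D D),
         generates iota T (fun t => A t (xi t)) U UD /\
         forall t s : R, 0 <= t -> t <= s -> s <= T ->
           [/\ `|UD t s| <= c2, `|U t s| <= c3
             & forall nu, M nu -> M (adjoint (U t s) nu)]) :
  exists U : R -> R -> dual B -> dual B,
    [/\ forall mu (s : R), M mu -> 0 <= s -> s <= T ->
          cauchy_solution iota T M A s mu (fun t => U t s mu) /\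
          forall m, cauchy_solution iota T M A s mu m ->
            forall t : R, s <= t -> t <= T -> m t = U t s mu,
        forward_propagator T M U
      & exists c : R,
          (forall mu eta (s t : R), M mu -> M eta -> 0 <= s -> s <= t -> t <= T ->
             `|adjoint iota (U t s mu - U t s eta)| <=
               c * `|adjoint iota (mu - eta)|) /\
          (forall mu (s t t' : R), M mu -> 0 <= s -> s <= t -> t <= T ->
             s <= t' -> t' <= T ->
             `|adjoint iota (U t s mu - U t' s mu)| <= c * `|t - t'|)].
Proof.
have exN := nonlinear_exists iota_dense M_convex M_bounded M_closedD c1_gt0
  c2_gt0 A_lipschitz A_generates.
(* One solution is selected for each initial time and point; inadmissible data get a constant
   curve. *)
have /choice[F FP] : forall p : R * dual B, exists m : R -> dual B,
    M p.2 -> 0 <= p.1 -> p.1 <= T -> nonlinear_solution iota M T A p.1 p.2 m.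
  move=> [s mu] /=.
  have [[s0 sT Mmu]|N] := pselect [/\ 0 <= s, s <= T & M mu].
    by have [m] := exN s mu s0 sT Mmu; exists m.
  by exists (fun=> mu) => Mmu s0 sT; case: N.
have solF s mu : M mu -> 0 <= s -> s <= T ->
    nonlinear_solution iota M T A s mu (F (s, mu)) by exact: (FP (s, mu)).
have cauchyF s mu : M mu -> 0 <= s -> s <= T ->
    cauchy_solution iota T M A s mu (F (s, mu)).
  by move=> Mmu s0 sT; apply: nonlinear_cauchy => //; exact: solF.
have uniqF s mu m t : M mu -> 0 <= s -> cauchy_solution iota T M A s mu m ->
    s <= t -> t <= T -> m t = F (s, mu) t.
  move=> Mmu s0 msol st tT; have sT := le_trans st tT.
  have stT : s <= t <= T by rewrite st.
  rewrite -(nonlinear_unique iota_dense M_convex M_bounded c1_gt0 c2_gt0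
    A_lipschitz A_generates s0 sT Mmu (cauchy_nonlinear s0 sT msol)
    (solF _ _ Mmu s0 sT) stT).
  by rewrite max_r.
have memF s mu t : M mu -> 0 <= s -> s <= t -> t <= T -> M (F (s, mu) t).
  move=> Mmu s0 st tT.
  by have [_ + _ _] := cauchyF s mu Mmu s0 (le_trans st tT); apply.
exists (fun t s mu => F (s, mu) t); split.
- by move=> mu s Mmu s0 sT; split=> [|m msol t]; [exact: cauchyF|exact: uniqF].
- split=> [t r r0 rt tT x Mx|t t0 tT x Mx|t s r r0 rs st tT x Mx].
  + exact: memF.
  + by have [] := cauchyF t x Mx t0 tT.
  + have sT := le_trans st tT; have rT := le_trans rs sT.
    (* The solution started at [r], restarted at time [s] from its own value, is the unique solution
       from there; this is the composition law. *)
    rewrite -(@uniqF _ _ (F (r, x)))//; first exact: memF.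
      exact: le_trans rs.
    exact: cauchy_solution_restrict rs (cauchyF _ _ Mx r0 rT).
(* The sum of the stability constant, with [t - s <= T], and the time-Lipschitz constant. It is
   fixed before any point of [M] is given, so the sign of [M0] is not yet known and [|M0|] keeps the
   second summand nonnegative. *)
- exists (2 * c2 * expR (2 * M0 * c1 * c2 * T) + `|M0| * c1); split.
    move=> mu eta s t Mmu Meta s0 st tT; have sT := le_trans st tT.
    have M00 : 0 <= M0 by apply: le_trans (M_bounded _ Mmu).
    have stT : s <= t <= T by rewrite st.
    apply: le_trans (nonlinear_stability iota_dense M_convex M_bounded c1_gt0
      c2_gt0 A_lipschitz A_generates s0 sT Mmu Meta (solF _ _ Mmu s0 sT)
      (solF _ _ Meta s0 sT) stT) _.
    rewrite ler_wpM2r// -[leLHS]addr0 lerD ?mulr_ge0 ?(ltW c1_gt0)//.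
    rewrite ler_wpM2l ?mulr_ge0 ?(ltW c2_gt0)// ler_expR.
    by rewrite ler_wpM2l ?mulr_ge0 ?(ltW c1_gt0) ?(ltW c2_gt0)//; lra.
  move=> mu s t t' Mmu s0 st tT st' t'T; have sT := le_trans st tT.
  have [_ _ Fsol] := solF s mu Mmu s0 sT.
  have MF q : s <= q <= T -> M (F (s, mu) q) by move=> /andP[? ?]; exact: memF.
  apply: le_trans (weak_solution_lipschitz (K := M0) (c := c1) _ _ Fsol _ _) _.
  + by move=> q /MF /M_bounded.
  + move=> q qsT; apply: (coefficient_bound A_lipschitz _ (MF q qsT)).
    by have /andP[sq ->] := qsT; rewrite (le_trans s0).
  + by rewrite st.
  + by rewrite st'.
  rewrite ler_wpM2r// -[leLHS]add0r lerD//.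
    by rewrite !mulr_ge0 ?expR_ge0 ?(ltW c2_gt0).
  by rewrite ler_wpM2r ?(ltW c1_gt0)// ler_norm.
Qed.
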